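(* Let $\overline{p}(n)$ denote the number of overpartitions of $n$, and for integers $c\geq 3$ and any residue $a$ modulo $c$ let $\overline{N}(a,c,n)$ denote the number of overpartitions of $n$ whose rank is congruent to $a$ modulo $c$. Then \begin{align*} &0.0019\,\overline{p}(n)<\overline{N}(a,3,n)<0.6648\,\overline{p}(n)\quad\text{for } n\geq 2089,\\ &0.0091\,\overline{p}(n)<\overline{N}(a,4,n)<0.4909\,\overline{p}(n)\quad\text{for } n\geq 272,\\ &0.0103\,\overline{p}(n)<\overline{N}(a,5,n)<0.3897\,\overline{p}(n)\quad\text{for } n\geq 449. \end{align*} Moreover, for every integer $c\geq 6$, defining \[ M_c:=1.691\times 10^{13}\,c^{20}\exp\left(\frac{16c^2(2c^2+\pi)}{\pi^2}\right), \] we have \[ \frac{1}{2c}\,\overline{p}(n)<\overline{N}(a,c,n)<\frac{3}{2c}\,\overline{p}(n)\quad\text{for all } n\geq M_c. \]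
   Context: An overpartition of a nonnegative integer $n$ is a partition of $n$ in which the first occurrence of each distinct part may be overlined. The rank of an overpartition $\lambda$ is its largest part minus its number of parts. *)

(* Defs.v *)
From HB Require Import structures.
From mathcomp Require Import all_boot all_order all_algebra.
From mathcomp Require Import reals sequences exp trigo.

Set Implicit Arguments.
Unset Strict Implicit.
Unset Printing Implicit Defensive.

Import Order.TTheory GRing.Theory Num.Theory.

(* A sequence of pairs (part, overlined?), with the parts in weakly decreasing
   order; the last conjunct says that an entry preceded by an equal part (that
   is, not a first occurrence) is not overlined. *)
Definition is_overpartition (n : nat) (s : seq (nat * bool)) : bool :=
  [&& sorted geq (unzip1 s),
      0 \notin unzip1 s,
      sumn (unzip1 s) == n
    & pairwise (fun x y => (x.1 == y.1) ==> ~~ y.2) s].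

Definition rank (s : seq (nat * bool)) : int :=
  ((\max_(k <- unzip1 s) k)%:Z - (size s)%:Z)%R.

(* Parts and number of parts of an overpartition of n are at most n, so the
   following finite type is large enough (overpartition_code below). *)
Definition code (n : nat) : finType := n.-bseq ('I_n.+1 * bool).

Definition decode (n : nat) (t : code n) : seq (nat * bool) :=
  [seq (nat_of_ord x.1, x.2) | x <- t].

Definition pbar (n : nat) : nat :=
  #|[set t : code n | is_overpartition n (decode t)]|.

Definition Nbar (a : int) (c n : nat) : nat :=
  #|[set t : code n | is_overpartition n (decode t)
                      & (rank (decode t) == a %[mod c])%Z]|.

Definition M (R : realType) (c : nat) : R :=
  (1691 * 10 ^+ 10 * c%:R ^+ 20
   * expR (16 * c%:R ^+ 2 * (2 * c%:R ^+ 2 + pi) / pi ^+ 2))%R.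

Lemma decode_inj (n : nat) : injective (@decode n).
Proof.
move=> t u /inj_map eq_tu; apply/val_inj/eq_tu => -[i b] [j d] /= [eq_ij ->].
by congr (_, _); apply: val_inj.
Qed.

Lemma overpartition_code (n : nat) (s : seq (nat * bool)) :
  is_overpartition n s -> exists t : code n, decode t = s.
Proof.
case/and4P=> _ s_gt0 /eqP sum_s _.
have size_s : size s <= n.
  rewrite -sum_s; elim: s s_gt0 {sum_s} => //= x s IHs.
  rewrite inE negb_or eq_sym -lt0n => /andP[x_gt0 /IHs].
  exact: leq_add x_gt0.
have part_s x : x \in s -> x.1 <= n.
  rewrite -sum_s; elim: s {s_gt0 sum_s size_s} => //= y s IHs.
  rewrite inE => /predU1P[-> | /IHs x_le]; first exact: leq_addr.
  exact: leq_trans x_le (leq_addl _ _).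
pose u := [seq (inord x.1 : 'I_n.+1, x.2) | x <- s].
have size_u : size u <= n by rewrite size_map.
exists (Bseq size_u); rewrite /decode /= -map_comp -[RHS]map_id.
apply/eq_in_map => -[k b] /part_s /= k_le.
by rewrite inordK.
Qed.

(* Main.v *)
(* Replacing a non-overlined part 2 by 1 + 1 lowers the rank by one, is injective,
   and applies to all overpartitions of n except those without a non-overlined 2
   and at most two others (where the largest part would drop). Hence, with
   p = pbar and d(n) = p(n) - p(n-2) the number of overpartitions of n without a
   non-overlined 2, the counts of two residue classes of the rank differ by at
   most d(n) + 2, and it suffices to show that d(n)/p(n) is small.

   For c = 3, 4, 5: the logarithmic derivative of the generating function of p
   gives n p(n) = sum_(m < n) sigma(n-m) p(m) with nonnegative sigma, whence
   n d(n) + 2 p(n-2) = sum_(m < n) sigma(n-m) d(m). Once d <= r p on a long enough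
   interval, these recurrences propagate the inequality for ever; the interval
   is checked by computing p(n) for n <= 210, with r = 23/100.

   For general c: the overpartitions of n without a non-overlined 2 have at most
   4 p(n) distinct parts in total, so at most p(n)/(4c) of them have at least 16c
   distinct parts; those with fewer distinct parts are only polynomially
   many, whereas p(n) >= 2^t as soon as t(t+1)/2 <= n. *)
Require Import Defs.
From Stdlib Require Import NArith.
From HB Require Import structures.
From mathcomp Require Import all_boot all_order all_algebra.
From mathcomp Require Import reals sequences exp trigo.
From mathcomp Require Import zify ring lra.

Set Implicit Arguments.
Unset Strict Implicit.
Unset Printing Implicit Defensive.

Import Order.TTheory GRing.Theory Num.Theory.

(** * Overpartitions as multisets of entries *)

(** Among equal parts the overlined copy comes first. This makes the order antisymmetric, so a
    sorted list is determined by its multiset of entries. *)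
Definition part_ge (x y : nat * bool) : bool :=
  (y.1 < x.1) || (x.1 == y.1) && (y.2 ==> x.2).

Lemma part_ge_total : total part_ge.
Proof. by move=> [i []] [j []]; rewrite /part_ge /= ?andbT ?andbF; lia. Qed.

Lemma part_ge_trans : transitive part_ge.
Proof.
by move=> [i []] [j []] [k []]; rewrite /part_ge /= ?andbT ?andbF; lia.
Qed.

Lemma part_ge_anti : antisymmetric part_ge.
Proof.
move=> [i b] [j d] ge_xy; suff [-> ->] : i = j /\ b = d by [].
by move: b d ge_xy => [] []; rewrite /part_ge /= ?andbT ?andbF; lia.
Qed.

(** The order-free half of the definition: it depends on the multiset only. *)
Definition valid_parts (s : seq (nat * bool)) : bool :=
  (0 \notin unzip1 s) && uniq [seq x <- s | x.2].

(** Sortedness and uniqueness all become pairwise conditions, and these agree pair by pair: only a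
    first occurrence is overlined exactly when overlined copies come first and are not repeated. *)
Lemma is_overpartitionE n s :
  is_overpartition n s =
    [&& sorted part_ge s, valid_parts s & sumn (unzip1 s) == n].
Proof.
have ge_trans : transitive geq by move=> x y z /= yx xz; apply: leq_trans yx.
rewrite /is_overpartition /valid_parts (sorted_pairwise ge_trans).
rewrite (sorted_pairwise part_ge_trans) pairwise_map.
have -> : pairwise part_ge s && ((0 \notin unzip1 s) &&
    uniq [seq x <- s | x.2] && (sumn (unzip1 s) == n)) =
  [&& pairwise part_ge s && uniq [seq x <- s | x.2], 0 \notin unzip1 s &
      sumn (unzip1 s) == n].
  by rewrite -!andbA; congr andb; rewrite andbCA.
have -> : pairwise part_ge s && uniq [seq x <- s | x.2] =
   pairwise (fun x y => (x.1 >= y.1) && ((x.1 == y.1) ==> ~~ y.2)) s.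
  have -> : uniq [seq x <- s | x.2] =
     pairwise (fun x y => ~~ ((x == y) && y.2)) s.
    elim: s => //= x s <-; case x2: x.2 => /=.
      congr (_ && _); rewrite mem_filter x2 /=.
      elim: s => //= y s; rewrite inE negb_or /= => ->.
      congr (_ && _).
      by case: eqVneq => [<-|]; rewrite ?x2.
    suff -> : all (fun y => ~~ ((x == y) && y.2)) s by [].
    by apply/allP => y _; case: eqVneq => [<-|]; rewrite ?x2.
  rewrite -pairwise_relI; apply: eq_pairwise => -[i b] [j d] /=.
  rewrite /part_ge xpair_eqE /=.
  by case: b d => [] []; rewrite ?andbT ?andbF /=; case: ltngtP.
rewrite pairwise_relI -!andbA; congr andb.
by rewrite [RHS]andbC -!andbA.
Qed.

Definition overpartitions (n : nat) : seq (seq (nat * bool)) :=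
  [seq decode t | t in [set t : code n | is_overpartition n (decode t)]].

Lemma mem_overpartitions n s :
  (s \in overpartitions n) = is_overpartition n s.
Proof.
apply/imageP/idP => [[t] | ov_s]; first by rewrite inE => ov_t ->.
by have [t def_s] := overpartition_code ov_s; exists t; rewrite ?inE def_s.
Qed.

Lemma overpartitions_uniq n : uniq (overpartitions n).
Proof. by rewrite map_inj_uniq ?enum_uniq//; apply: decode_inj. Qed.

Lemma pbarE n : pbar n = size (overpartitions n).
Proof. by rewrite size_image. Qed.

Definition ovcount (P : pred (seq (nat * bool))) (n : nat) : nat :=
  count P (overpartitions n).

Lemma NbarE a c n :
  Nbar a c n = ovcount (fun s => (rank s == a %[mod c])%Z) n.
Proof.
rewrite /ovcount count_map -size_filter /Nbar cardsE cardE /enum_mem.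
rewrite -!filter_predI; congr size; apply: eq_filter => t /=.
by rewrite !inE andbC.
Qed.

Lemma perm_valid s t : perm_eq s t -> valid_parts s = valid_parts t.
Proof.
move=> st; congr (~~ _ && _); first exact/perm_mem/perm_map.
exact/perm_uniq/perm_filter.
Qed.

Lemma perm_sumn1 (s t : seq (nat * bool)) :
  perm_eq s t -> sumn (unzip1 s) = sumn (unzip1 t).
Proof. by move=> st; apply/perm_sumn/perm_map. Qed.

Lemma overpartition_perm n m s t : s \in overpartitions n ->
  t \in overpartitions m -> perm_eq s t -> s = t.
Proof.
rewrite !mem_overpartitions !is_overpartitionE => /and3P[ss _ _] /and3P[st _ _].
exact: (sorted_eq part_ge_trans part_ge_anti).
Qed.

Lemma sort_overpartition n s : valid_parts s -> sumn (unzip1 s) = n ->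
  sort part_ge s \in overpartitions n.
Proof.
move=> vs <-; rewrite mem_overpartitions is_overpartitionE.
have st : perm_eq (sort part_ge s) s by rewrite perm_sort.
by rewrite (sort_sorted part_ge_total) (perm_valid st) vs (perm_sumn1 st) eqxx.
Qed.

Lemma ovcount_inj (P Q : pred (seq (nat * bool))) n m f :
  (forall s, s \in overpartitions n -> P s ->
     (f s \in overpartitions m) && Q (f s)) ->
  (forall s t, s \in overpartitions n -> t \in overpartitions n ->
     P s -> P t -> f s = f t -> s = t) ->
  ovcount P n <= ovcount Q m.
Proof.
move=> fP f_inj; rewrite /ovcount -!size_filter -(size_map f).
apply: uniq_leq_size => [|_ /mapP[s + ->]].
  rewrite map_inj_in_uniq ?filter_uniq ?overpartitions_uniq// => s t.
  by rewrite !mem_filter => /andP[Ps ss] /andP[Pt tt]; apply: f_inj.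
by rewrite !mem_filter andbC => /andP[ss Ps]; rewrite andbC fP.
Qed.

(** * Inserting and removing one part *)

Definition insert_part (x : nat * bool) s := sort part_ge (x :: s).

Lemma insert_part_perm x s : perm_eq (insert_part x s) (x :: s).
Proof. by rewrite perm_sort. Qed.

Lemma valid_cons x s : 0 < x.1 ->
  valid_parts (x :: s) = valid_parts s && ~~ (x.2 && (x \in s)).
Proof.
case: x => k [] /= k_gt0; rewrite /valid_parts /= inE negb_or eq_sym -lt0n k_gt0 /=.
  by rewrite mem_filter /= -andbA [uniq _ && _]andbC.
by rewrite andbT.
Qed.

Lemma overpartition_gt0 n s x : s \in overpartitions n -> x \in s -> 0 < x.1.
Proof.
rewrite mem_overpartitions => /and4P[_ s0 _ _] xs.
rewrite lt0n; apply: contraNneq s0 => <-; exact: map_f.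
Qed.

Lemma rem_overpartition n s x : s \in overpartitions n -> x \in s ->
  rem x s \in overpartitions (n - x.1).
Proof.
move=> ss xs; have x0 := overpartition_gt0 ss xs.
have st := perm_to_rem xs.
move: ss; rewrite !mem_overpartitions !is_overpartitionE => /and3P[so + /eqP <-].
rewrite (perm_valid st) valid_cons// => /andP[-> _].
by rewrite (subseq_sorted part_ge_trans (rem_subseq x s) so) (perm_sumn1 st) /= addKn.
Qed.

Lemma count_overlined n s k : s \in overpartitions n ->
  count_mem (k, true) s = ((k, true) \in s).
Proof.
rewrite mem_overpartitions is_overpartitionE => /and3P[_ /andP[_ us] _].
have := count_uniq_mem (k, true) us; rewrite mem_filter /= count_filter => <-.
by apply: eq_count => y /=; case: eqVneq => [->|].
Qed.

(** Removing one copy of [x] inverts inserting it; an overlined [x] can be inserted only where it is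
    absent. *)
Lemma perm_overpartitions_mem x n : 0 < x.1 ->
  perm_eq [seq s <- overpartitions (n + x.1) | x \in s]
    [seq insert_part x t | t <- overpartitions n & ~~ (x.2 && (x \in t))].
Proof.
move=> x0; apply: uniq_perm.
- by rewrite filter_uniq ?overpartitions_uniq.
- rewrite map_inj_in_uniq ?filter_uniq ?overpartitions_uniq// => s t.
  rewrite !mem_filter => /andP[_ ss] /andP[_ tt] eq_st.
  apply: (overpartition_perm ss tt).
  by rewrite -(perm_cons x) -(permPl (insert_part_perm x s)) eq_st insert_part_perm.
move=> s; rewrite mem_filter; apply/andP/mapP => [[xs ss]|[t + ->]].
  have st := perm_to_rem xs.
  move: (ss); rewrite mem_overpartitions is_overpartitionE => /and3P[so vs /eqP su].
  move: vs; rewrite (perm_valid st) valid_cons// => /andP[vr xr].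
  have := rem_overpartition ss xs; rewrite addnK => rr.
  exists (rem x s); first by rewrite mem_filter xr.
  apply: (@overpartition_perm (n + x.1) (n + x.1)) => //.
    apply: sort_overpartition; first by rewrite valid_cons ?vr.
    by rewrite -(perm_sumn1 st).
  by rewrite (permPl st) perm_sym insert_part_perm.
rewrite mem_filter => /andP[xt tt].
rewrite (perm_mem (insert_part_perm x t)) mem_head; split=> //.
move: tt; rewrite mem_overpartitions is_overpartitionE => /and3P[so vs /eqP su].
apply: sort_overpartition; first by rewrite valid_cons ?vs.
by rewrite /= su addnC.
Qed.

Lemma overpartition_le n s x : s \in overpartitions n -> x \in s -> x.1 <= n.
Proof.
rewrite mem_overpartitions is_overpartitionE => /and3P[_ _ /eqP <-].
by move=> /perm_to_rem/perm_sumn1 -> /=; rewrite leq_addr.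
Qed.

Lemma sum_overpartitions_mem (F : seq (nat * bool) -> nat) x n :
  (forall s t, perm_eq s t -> F s = F t) -> 0 < x.1 ->
  \sum_(s <- overpartitions (n + x.1) | x \in s) F s =
  \sum_(t <- overpartitions n | ~~ (x.2 && (x \in t))) F (x :: t).
Proof.
move=> Fperm x0; rewrite -big_filter (perm_big _ (perm_overpartitions_mem n x0)).
rewrite big_map big_filter; apply: eq_bigr => t _.
exact/Fperm/insert_part_perm.
Qed.

Lemma ovcount_predT n : ovcount predT n = pbar n.
Proof. by rewrite /ovcount count_predT pbarE. Qed.

(** * Counting overpartitions with forbidden entries *)

Definition avoids (L s : seq (nat * bool)) : bool := all (fun x => x \notin L) s.

Definition avoid_count L n := ovcount (avoids L) n.

Lemma avoids_cons x L s : avoids (x :: L) s = (x \notin s) && avoids L s.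
Proof.
elim: s => //= y s; rewrite /avoids /= => ->.
by rewrite !inE !negb_or [y == x]eq_sym -!andbA; congr andb; rewrite andbCA.
Qed.

Lemma avoids_perm L s t : perm_eq s t -> avoids L s = avoids L t.
Proof. by move=> st; apply: perm_all. Qed.

Lemma avoid_count_nil n : avoid_count [::] n = pbar n.
Proof.
by rewrite -ovcount_predT; apply: eq_count => s; rewrite /avoids all_predT.
Qed.

Lemma ovcountID P x n : ovcount P n =
  ovcount (fun s => (x \notin s) && P s) n +
  \sum_(s <- overpartitions n | x \in s) P s.
Proof.
rewrite /ovcount -!sum1_count big_mkcond (bigID (fun s => x \in s)) /= addnC.
by congr addn; rewrite [RHS]big_mkcondr.
Qed.

(** Forbidding a non-overlined k multiplies the generating function by 1 - q^k. *)
Lemma avoid_count_false L k n : 0 < k -> (k, false) \notin L ->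
  avoid_count L (n + k) = avoid_count ((k, false) :: L) (n + k) + avoid_count L n.
Proof.
move=> k0 kL; rewrite [LHS](ovcountID _ (k, false)); congr (_ + _).
  by apply: eq_count => s; rewrite avoids_cons.
rewrite (@sum_overpartitions_mem (fun s => avoids L s) (k, false))//=.
  rewrite /avoid_count /ovcount -sum1_count [RHS]big_mkcond /=.
  by apply: eq_bigr => s _; rewrite /avoids /= kL; case: all.
by move=> s t st; rewrite (avoids_perm _ st).
Qed.

(** Forbidding an overlined k divides the generating function by 1 + q^k. *)
Lemma avoid_count_true L k n : 0 < k -> (k, true) \notin L ->
  avoid_count L (n + k) = avoid_count ((k, true) :: L) (n + k) +
                          avoid_count ((k, true) :: L) n.
Proof.
move=> k0 kL; rewrite [LHS](ovcountID _ (k, true)); congr (_ + _).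
  by apply: eq_count => s; rewrite avoids_cons.
rewrite (@sum_overpartitions_mem (fun s => avoids L s) (k, true))//=.
  rewrite /avoid_count /ovcount -sum1_count big_mkcond [RHS]big_mkcond /=.
  by apply: eq_bigr => s _; rewrite avoids_cons /avoids /= kL;
    case: (_ \notin s); case: all.
by move=> s t st; rewrite (avoids_perm _ st).
Qed.

Lemma leq_avoid_count L k n : 0 < k -> (k, false) \notin L ->
  avoid_count L n <= avoid_count L (n + k).
Proof. by move=> k0 kL; rewrite avoid_count_false// leq_addl. Qed.

(** Any subset of 1, ..., t can serve as the set of overlined parts; non-overlined 1s fill up the
    rest, as t(t+1)/2 is at most n. *)
Lemma expn2_leq_avoid_count t L n : (1, false) \notin L ->
  (forall j, 0 < j <= t -> (j, true) \notin L) -> t * t.+1 <= n.*2 ->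
  2 ^ t <= avoid_count L n.
Proof.
move=> L1; elim: t L L1 n => [|t IHt] L L1 n Lt tn.
  elim: n {tn} => [|n IHn].
    rewrite /avoid_count /ovcount -has_count; apply/hasP; exists [::] => //.
    by rewrite mem_overpartitions.
  by apply: (leq_trans IHn); rewrite -addn1 leq_avoid_count.
have tn' : t.+1 <= n by move: tn; rewrite -muln2; nia.
have L1' : (1, false) \notin (t.+1, true) :: L.
  by rewrite inE negb_or xpair_eqE andbF.
have Lt' j : 0 < j <= t -> (j, true) \notin (t.+1, true) :: L.
  move=> jt; rewrite inE negb_or Lt ?andbT; last by lia.
  by rewrite xpair_eqE andbT; lia.
rewrite -(subnK tn') avoid_count_true//; last by rewrite Lt//; lia.
rewrite expnS mul2n -addnn leq_add// IHt//; move: tn; rewrite -!muln2; nia.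
Qed.

(** * Multiplicities and the recurrence for [pbar] *)

Definition multiplicities x n := \sum_(s <- overpartitions n) count_mem x s.

Lemma multiplicitiesE x n :
  multiplicities x n = \sum_(s <- overpartitions n | x \in s) count_mem x s.
Proof.
rewrite /multiplicities (bigID (fun s => x \in s)) /= addnC big1 ?add0n// => s xs.
exact/count_memPn.
Qed.

Lemma multiplicities_small x n : n < x.1 -> multiplicities x n = 0.
Proof.
move=> nx; rewrite multiplicitiesE big_seq_cond big1// => s /andP[ss xs].
by have := overpartition_le ss xs; rewrite leqNgt nx.
Qed.

Lemma multiplicities_false k n : 0 < k ->
  multiplicities (k, false) (n + k) = multiplicities (k, false) n + pbar n.
Proof.
move=> k0; rewrite multiplicitiesE (@sum_overpartitions_mem _ (k, false))//=.
  under eq_bigr do rewrite eqxx /= addnC.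
  by rewrite big_split /= sum1_size -pbarE.
by move=> s t /permP.
Qed.

Lemma multiplicities_true k n : 0 < k ->
  multiplicities (k, true) (n + k) + multiplicities (k, true) n = pbar n.
Proof.
move=> k0; rewrite multiplicitiesE (@sum_overpartitions_mem _ (k, true))//=.
  rewrite /multiplicities pbarE -sum1_size.
  rewrite big_mkcond -big_split !big_seq /=; apply: eq_bigr => s.
  by move=> ss; rewrite eqxx (count_overlined _ ss); case: (_ \in _).
by move=> s t /permP.
Qed.

Definition size_total k n :=
  multiplicities (k, false) n + multiplicities (k, true) n.

(** With P the generating function of [pbar], that of [size_total k] is P (q^k/(1 - q^k) + q^k/(1 +
    q^k)) = 2 P q^k/(1 - q^(2k)), hence a recurrence with step 2k. *)
Lemma size_totalD k n : 0 < k ->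
  size_total k (n + k + k) = size_total k n + (pbar (n + k)).*2.
Proof.
move=> k0; rewrite /size_total !multiplicities_false//.
have := multiplicities_true (n + k) k0; have := multiplicities_true n k0.
move: (multiplicities (k, true) (n + k + k)) (multiplicities (k, true) (n + k)).
move: (multiplicities _ n) (multiplicities _ n) (pbar (n + k)) (pbar n).
by move=> *; lia.
Qed.

(** For positive j and k, the coefficient of q^j in 2 q^k/(1 - q^(2k)). *)
Definition odd_quotient k j : nat := if (k %| j) && odd (j %/ k) then 2 else 0.

Lemma odd_quotient_small k j : 0 < j < k -> odd_quotient k j = 0.
Proof.
move=> /andP[j0 jk]; rewrite /odd_quotient; case: dvdnP => //=.
move=> [q def_j].
by exfalso; case: q def_j => [|q]; rewrite ?mulSn; lia.
Qed.

Lemma odd_quotientD k j : 0 < k -> odd_quotient k (j + k + k) = odd_quotient k j.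
Proof.
move=> k0; rewrite /odd_quotient -addnA addnn -mul2n.
by rewrite dvdn_addl ?dvdn_mull// divnDMl// oddD /= addbF.
Qed.

Lemma odd_quotient_near k j : 0 < k -> 0 < j <= k + k ->
  odd_quotient k j = (j == k).*2.
Proof.
move=> k0 jk; rewrite /odd_quotient; case: eqVneq => [->|jNk].
  by rewrite dvdnn divnn k0.
case: dvdnP => //= -[q def_j]; rewrite def_j mulnK//.
have [q1 | ->//] : q = 1 \/ q = 2 by nia.
by move: jNk; rewrite def_j q1 mul1n eqxx.
Qed.

Lemma size_totalE k n : 0 < k ->
  size_total k n = \sum_(m < n) odd_quotient k (n - m) * pbar m.
Proof.
(* On a window of length at most 2k ending at [n'], only the term at distance k survives. *)
move=> k0; have near n' i (g := fun m => odd_quotient k (n' - m) * pbar m) :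
    i <= n' <= i + k + k ->
    \sum_(i <= m < n') g m = (if i + k <= n' then (pbar (n' - k)).*2 else 0).
  move=> in'; case: ifP => ikn.
    rewrite (bigD1_seq (n' - k)) ?mem_index_iota ?iota_uniq//=; last by lia.
    rewrite big1_seq ?addn0 => [|m /andP[mk]].
      by rewrite /g subKn ?odd_quotient_near ?eqxx//; lia.
    rewrite mem_index_iota => mn; rewrite /g odd_quotient_near//; last by lia.
    by case: eqP => //; lia.
  rewrite big1_seq// => m /andP[_]; rewrite mem_index_iota => mn.
  rewrite /g odd_quotient_near//; last by lia.
  by case: eqP => //; lia.
rewrite -(big_mkord predT (fun m => odd_quotient k (n - m) * pbar m)).
have [q] := ubnP n; elim: q n => // q IHq n nq.
have [kkn|nkk] := leqP (k + k) n.
  have -> : n = (n - k - k) + k + k by lia.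
  set n' := n - k - k; rewrite size_totalD// IHq; last by lia.
  rewrite [RHS](@big_cat_nat _ _ _ n')//=; last by lia.
  congr (_ + _).
    apply: eq_big_nat => m mn; congr (_ * _).
    have -> : n' + k + k - m = n' - m + k + k by lia.
    by rewrite odd_quotientD.
  rewrite near; last by lia.
  by rewrite ifT ?addnK//; lia.
rewrite near; last by lia.
rewrite add0n; case: leqP => kn; last first.
  by rewrite /size_total !multiplicities_small.
rewrite -[in LHS](subnK kn) /size_total multiplicities_false//.
have := multiplicities_true (n - k) k0.
rewrite !(@multiplicities_small _ (n - k)) /=; lia.
Qed.

(** Twice the sum of the divisors k of j with j / k odd. *)
Definition sigma_odd j := \sum_(1 <= k < j.+1) k * odd_quotient k j.

Lemma sumn_unzip1 n (s : seq (nat * bool)) : all (fun x => 0 < x.1 <= n) s ->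
  sumn (unzip1 s) = \sum_(1 <= k < n.+1)
    k * (count_mem (k, false) s + count_mem (k, true) s).
Proof.
elim: s => [|[i b] s IHs] /=; first by rewrite big1// => k; rewrite muln0.
case/andP=> i_n /IHs ->.
rewrite -[in LHS](_ : \sum_(1 <= k < n.+1) k * (i == k) = i).
  rewrite -big_split; apply: eq_bigr => k _ /=; rewrite -mulnDr; congr (_ * _).
  by rewrite !xpair_eqE; case: b; rewrite ?andbT ?andbF; lia.
rewrite (bigD1_seq i) ?mem_index_iota ?iota_uniq//=.
rewrite eqxx muln1 big1 ?addn0// => k; rewrite eq_sym => /negPf ->.
by rewrite muln0.
Qed.

(* Both sides count the total size of all overpartitions of n; equivalently,
   this is the logarithmic derivative of prod (1 + q^k) / (1 - q^k). *)
Lemma pbar_rec n : n * pbar n = \sum_(m < n) sigma_odd (n - m) * pbar m.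
Proof.
transitivity (\sum_(s <- overpartitions n) sumn (unzip1 s)).
  rewrite big_seq (eq_bigr (fun=> n)) => [|s]; last first.
    by rewrite mem_overpartitions => /and4P[_ _ /eqP].
  by rewrite -big_seq big_const_seq count_predT iter_addn_0 pbarE mulnC.
rewrite big_seq (eq_bigr (fun s => \sum_(1 <= k < n.+1)
    k * (count_mem (k, false) s + count_mem (k, true) s))) => [|s ss]; last first.
  apply: sumn_unzip1; apply/allP => x xs.
  by rewrite (overpartition_gt0 ss xs) (overpartition_le ss xs).
rewrite -big_seq exchange_big /=.
under eq_bigr do rewrite -big_distrr big_split /= -/(size_total _ _).
rewrite (@eq_big_nat _ _ _ _ _ _ (fun k =>
    \sum_(m < n) k * (odd_quotient k (n - m) * pbar m))) => [|k /andP[k0 _]].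
  2: by rewrite size_totalE// big_distrr.
rewrite exchange_big /=; apply: eq_bigr => m _.
under eq_bigr do rewrite mulnA.
rewrite -big_distrl; congr (_ * _); have mn := ltn_ord m.
rewrite (@big_cat_nat _ _ _ (n - m).+1)//=; last by lia.
rewrite [X in _ + X]big_nat [X in _ + X]big1 ?addn0// => k kn.
by rewrite odd_quotient_small ?muln0//; lia.
Qed.

(** * Overpartitions without a non-overlined 2 *)

Definition no_two_count n := avoid_count [:: (2, false)] n.

Lemma pbar_no_two n : pbar n.+2 = no_two_count n.+2 + pbar n.
Proof. by rewrite -!avoid_count_nil -addn2 avoid_count_false. Qed.

Lemma no_two_count_small n : n < 2 -> no_two_count n = pbar n.
Proof.
move=> n2; rewrite -avoid_count_nil; apply: eq_in_count => s ss.
rewrite avoids_cons; case: (boolP (_ \in s)) => //= s2.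
by have := overpartition_le ss s2; rewrite leqNgt n2.
Qed.

(** Subtract the recurrence at [n] from that at [n.+2]; the different factors [n.+2] and [n] leave
    [2 * pbar n]. *)
Lemma no_two_count_rec n : n.+2 * no_two_count n.+2 + 2 * pbar n =
  \sum_(m < n.+2) sigma_odd (n.+2 - m) * no_two_count m.
Proof.
have := pbar_rec n.+2; rewrite pbar_no_two mulnDr.
set F := fun m => sigma_odd (n.+2 - m) * no_two_count m.
suff -> : \sum_(m < n.+2) sigma_odd (n.+2 - m) * pbar m =
    \sum_(m < n.+2) F m + n * pbar n by rewrite /F; nia.
rewrite pbar_rec !big_ord_recl /= /bump /= !add1n /F !no_two_count_small// -!addnA.
do 2!congr addn; rewrite -big_split; apply: eq_bigr => m _ /=.
by rewrite /bump /= !add1n !subSS pbar_no_two mulnDr.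
Qed.

Lemma sigma_odd_le j : sigma_odd j <= 2 * j ^ 2.
Proof.
rewrite /sigma_odd; apply: (@leq_trans (\sum_(1 <= k < j.+1) (2 * j))).
  rewrite big_nat [leqRHS]big_nat; apply: leq_sum => k kj.
  by rewrite mulnC leq_mul ?/odd_quotient//; [case: ifP | lia].
by rewrite sum_nat_const_nat; nia.
Qed.

(* With e(m) = v d(m) - u p(m), where d = no_two_count, the two recurrences give
   n e(n) = \sum_(m < n) sigma(n - m) e(m) - 2 v p(n - 2): once e <= 0 on a long
   enough range, the last term absorbs the finitely many positive e(m). *)
Lemma no_two_ratio u v A B C : 2 <= B ->
  (forall m, A <= m < B -> v * no_two_count m <= u * pbar m) ->
  \sum_(m < A) (v * no_two_count m - u * pbar m) <= v * C ->
  (forall n, B <= n.+2 -> C * n.+2 ^ 2 <= pbar n) ->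
  forall n, A <= n -> v * no_two_count n <= u * pbar n.
Proof.
move=> B2 baseAB sumA growth n; have [q] := ubnP n; elim: q n => // q IHq n nq An.
have [nB|] := ltnP n B; first by rewrite baseAB ?An.
case: n => [|[|n]] in nq An *; [lia | lia |] => Bn.
(* Subtraction is truncated, so [E m] is the positive part of e(m) and vanishes for A <= m < n.+2 by
   induction. *)
set E := fun m => v * no_two_count m - u * pbar m.
have sumE : \sum_(m < n.+2) E m <= v * C.
  rewrite -(big_mkord predT) (@big_cat_nat _ _ _ A)//= [X in _ + X]big_nat.
  rewrite [X in _ + X]big1 ?addn0 ?big_mkord// => m /andP[Am mn].
  by apply/eqP; rewrite subn_eq0 IHq//; lia.
have le1 : \sum_(m < n.+2) sigma_odd (n.+2 - m) * (v * no_two_count m) <=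
    \sum_(m < n.+2) sigma_odd (n.+2 - m) * (u * pbar m) +
    2 * n.+2 ^ 2 * \sum_(m < n.+2) E m.
  rewrite big_distrr -big_split; apply: leq_sum => m _ /=.
  apply: (@leq_trans (sigma_odd (n.+2 - m) * (u * pbar m + E m))).
    by rewrite leq_mul// /E; lia.
  rewrite mulnDr leq_add2l leq_mul//; apply: (leq_trans (sigma_odd_le _)).
  by rewrite leq_mul// leq_exp2r// leq_subr.
have sumZ c f : \sum_(m < n.+2) sigma_odd (n.+2 - m) * (c * f m) =
    c * \sum_(m < n.+2) sigma_odd (n.+2 - m) * f m.
  by rewrite big_distrr; apply: eq_bigr => m _; rewrite mulnCA.
move: le1; rewrite (sumZ v no_two_count) (sumZ u pbar).
rewrite -no_two_count_rec -pbar_rec => le1.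
have le2 : 2 * n.+2 ^ 2 * \sum_(m < n.+2) E m <= 2 * v * pbar n.
  apply: (@leq_trans (2 * n.+2 ^ 2 * (v * C))); first by rewrite leq_mul.
  have := growth n Bn; move: (n.+2 ^ 2) => x; nia.
rewrite -(@leq_pmul2l n.+2)//.
move: le1 le2; move: (2 * n.+2 ^ 2 * _) => y; nia.
Qed.

(** * Quadratic lower bounds for [pbar] *)

Definition no_one_count n := avoid_count [:: (1, false)] n.
Definition no_one_two_count n := avoid_count [:: (2, false); (1, false)] n.

Lemma pbar_no_one n : pbar n.+1 = no_one_count n.+1 + pbar n.
Proof. by rewrite -!avoid_count_nil -addn1 avoid_count_false. Qed.

Lemma no_one_no_one_two n :
  no_one_count n.+2 = no_one_two_count n.+2 + no_one_count n.
Proof. by rewrite -addn2 [LHS]avoid_count_false. Qed.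

Lemma leq_no_one_two n : no_one_two_count n <= no_one_two_count n.+3.
Proof. by rewrite -[n.+3]addn3; apply: leq_avoid_count. Qed.

(** Discrete integration. Adding a part 3 shows that the bound [4 * C] persists. A step of 2 raises
    [C * (2 * m + 3)] by [4 * C], and a step of 1 raises [C * (m + 2) ^ 2] by
    [C * (2 * (m + 1) + 3)], so the linear and quadratic bounds follow in turn. *)
Lemma pbar_quadratic C N :
  (forall i, i < 3 -> 4 * C <= no_one_two_count (N + i)) ->
  (forall i, i < 2 -> C * (2 * (N + i) + 3) <= no_one_count (N + i)) ->
  C * N.+2 ^ 2 <= pbar N ->
  forall n, N <= n -> C * n.+2 ^ 2 <= pbar n.
Proof.
move=> base12 base1 base n Nn; rewrite -(subnKC Nn); move: (n - N) => {n Nn} i.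
have ge12 j : 4 * C <= no_one_two_count (N + j).
  have [q] := ubnP j; elim: q j => // q IHq [|[|[|j]]] jq; try exact: base12.
  apply: (leq_trans (IHq j _)); first by lia.
  by rewrite !addnS leq_no_one_two.
have ge1 j : C * (2 * (N + j) + 3) <= no_one_count (N + j).
  have [q] := ubnP j; elim: q j => // q IHq [|[|j]] jq; try exact: base1.
  have := IHq j; have := ge12 j.+2; rewrite !addnS no_one_no_one_two.
  by move=> + /(_ ltac:(lia)); nia.
elim: i => [|i IHi]; first by rewrite addn0.
have := ge1 i.+1; rewrite !addnS pbar_no_one; move: IHi; nia.
Qed.

(** * Evaluating [pbar] in binary arithmetic and checking the ratio *)

Fixpoint dotN (s t : seq N) : N :=
  match s, t with
  | x :: s', y :: t' => N.add (N.mul x y) (dotN s' t')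
  | _, _ => 0%num
  end.

Lemma dotNE s t : size t <= size s -> N.to_nat (dotN s t) =
  \sum_(i < size t) N.to_nat (nth 0%num s i) * N.to_nat (nth 0%num t i).
Proof.
elim: t s => [|y t IHt] [|x s]//= st; rewrite ?big_ord0//.
by rewrite big_ord_recl /= N2Nat.inj_add N2Nat.inj_mul IHt.
Qed.

Definition sumN (s : seq N) : N := foldr N.add 0%num s.

Lemma sumNE (F : nat -> N) s :
  N.to_nat (sumN (map F s)) = \sum_(k <- s) N.to_nat (F k).
Proof.
by elim: s => [|k s IHs]; rewrite ?big_nil ?big_cons//= N2Nat.inj_add IHs.
Qed.

Definition sigma_oddN j : N :=
  sumN [seq N.of_nat (k * odd_quotient k j) | k <- iota 1 j].

Lemma sigma_oddNE j : N.to_nat (sigma_oddN j) = sigma_odd j.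
Proof.
rewrite /sigma_oddN sumNE /sigma_odd /index_iota subSS subn0.
by apply: eq_bigr => k _; rewrite Nat2N.id.
Qed.

(** The newest value comes first, so if [sg] lists [sigma_odd] from 1 on and [l] has size n, the dot
    product pairs [sigma_odd j] with [pbar (n - j)]; by [pbar_rec] the division is exact. *)
Definition pbar_step (sg l : seq N) : seq N :=
  N.div (dotN sg l) (N.of_nat (size l)) :: l.

(* pbar 0, ..., pbar L *)
Definition pbar_table L : seq N :=
  rev (iter L (pbar_step [seq sigma_oddN j | j <- iota 1 L]) [:: 1%num]).

Lemma pbar0 : pbar 0 = 1.
Proof.
have := @expn2_leq_avoid_count 0 [::] 0; rewrite avoid_count_nil => pbar_gt0.
apply/eqP; rewrite eqn_leq pbar_gt0// andbT pbarE; apply: (@uniq_leq_size _ _ [:: [::]]).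
  exact: overpartitions_uniq.
case=> // x s ss; have := overpartition_le ss (mem_head x s).
by have := overpartition_gt0 ss (mem_head x s); lia.
Qed.

Lemma pbar_tableE L m : m <= L ->
  N.to_nat (nth 0%num (pbar_table L) m) = pbar m.
Proof.
move=> mL; set sg := [seq sigma_oddN j | j <- iota 1 L].
have tabE n : n <= L ->
    iter n (pbar_step sg) [:: 1%num] = [seq N.of_nat (pbar (n - i)) | i <- iota 0 n.+1].
  elim: n => [|n IHn] nL; first by rewrite /= pbar0.
  rewrite iterS IHn ?(ltnW nL)// /pbar_step [iota 0 n.+2]/= map_cons subn0.
  rewrite -[1 :: iota 2 n]/(iota (1 + 0) n.+1) iotaDl -map_comp; congr (_ :: _).
  rewrite size_map size_iota.
  suff -> : dotN sg [seq N.of_nat (pbar (n - i)) | i <- iota 0 n.+1] =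
      N.mul (N.of_nat (pbar n.+1)) (N.of_nat n.+1) by rewrite N.div_mul//; lia.
  apply: N2Nat.inj; rewrite N2Nat.inj_mul !Nat2N.id.
  rewrite -[RHS]/(pbar n.+1 * n.+1)%N mulnC dotNE; last first.
    by rewrite !size_map !size_iota.
  rewrite size_map size_iota pbar_rec.
  rewrite (reindex_inj rev_ord_inj); apply: eq_bigr => -[i ilt] _ /=.
  rewrite (nth_map 0) ?size_iota ?nth_iota ?sigma_oddNE; try by lia.
  rewrite -[_ :: _]/[seq N.of_nat (pbar (n - i0)) | i0 <- iota 0 n.+1].
  rewrite (nth_map 0) ?size_iota ?nth_iota ?Nat2N.id; try by lia.
  by congr (sigma_odd _ * pbar _); lia.
rewrite /pbar_table tabE// nth_rev ?size_map ?size_iota//.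
rewrite (nth_map 0) ?size_iota ?nth_iota ?Nat2N.id; try by lia.
by congr pbar; lia.
Qed.

Section Table.
Variable T : seq N.
Let p m : N := nth 0%num T m.
Let p1 m : N := N.sub (p m) (p m.-1).
Let p12 m : N := N.sub (p1 m) (p1 m.-2).
Let d m : N := if (m < 2)%N then p m else N.sub (p m) (p m.-2).

(** The first two tests are hypotheses of [no_two_ratio]; the other three are those of
    [pbar_quadratic] at [B - 2], which yields the growth hypothesis. *)
Definition ratio_check (u v c : N) (A B : nat) : bool :=
  [&& all (fun m => N.leb (N.mul v (d m)) (N.mul u (p m))) (iota A (B - A)),
      N.leb (sumN [seq N.sub (N.mul v (d m)) (N.mul u (p m)) | m <- iota 0 A])
        (N.mul v c),
      all (fun i => N.leb (N.mul 4%num c) (p12 (B - 2 + i))) (iota 0 3),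
      all (fun i => N.leb (N.mul c (N.of_nat (2 * (B - 2 + i) + 3)))
                      (p1 (B - 2 + i))) (iota 0 2)
    & N.leb (N.mul c (N.of_nat (B ^ 2)%N)) (p (B - 2))].

Hypothesis TE : forall m, m < size T -> N.to_nat (p m) = pbar m.

Lemma ratio_checkP u v c A B : 5 <= B -> A <= B -> B < size T ->
  ratio_check u v c A B ->
  forall n, A <= n ->
    N.to_nat v * no_two_count n <= N.to_nat u * pbar n.
Proof.
move=> B2 AB BT /and5P[/allP chk /N.leb_le sumA /allP chk12 /allP chk1 /N.leb_le chk0].
have dE m : m < size T -> N.to_nat (d m) = no_two_count m.
  case: m => [|[|m]] mT; rewrite /d /=.
  - by rewrite TE// no_two_count_small.
  - by rewrite TE// no_two_count_small.
  - by have := TE mT; have := @TE m ltac:(lia); have := pbar_no_two m; lia.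
have p1E m : 0 < m < size T -> N.to_nat (p1 m) = no_one_count m.
  case: m => // m mT; rewrite /p1 /=.
  by have := @TE m.+1 ltac:(lia); have := @TE m ltac:(lia); have := pbar_no_one m; lia.
(* Index 2 is excluded: [p1 0] is 0 by truncation, whereas [no_one_count 0] is 1. *)
have p12E m : 2 < m < size T -> N.to_nat (p12 m) = no_one_two_count m.
  case: m => [|[|m]]// mT; rewrite /p12 /=.
  have := @p1E m.+2 ltac:(lia); have := @p1E m ltac:(lia).
  by have := no_one_no_one_two m; lia.
apply: (@no_two_ratio _ _ _ B (N.to_nat c)) => //.
- by lia.
- move=> m mAB; rewrite -dE -?TE; [|lia|lia].
  have /chk/N.leb_le : m \in iota A (B - A) by rewrite mem_iota; lia.
  by lia.
- rewrite -(big_mkord predT (fun m => N.to_nat v * no_two_count m - N.to_nat u * pbar m)).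
  rewrite /index_iota subn0 big_seq.
  rewrite (eq_bigr (fun m => N.to_nat (N.sub (N.mul v (d m)) (N.mul u (p m))))).
    by rewrite -big_seq -sumNE; lia.
  by move=> m; rewrite mem_iota => mA; rewrite -dE -?TE; lia.
move=> n Bn; apply: (@pbar_quadratic _ (B - 2)); last by lia.
- move=> i i3; rewrite -p12E; last by lia.
  have /chk12/N.leb_le : i \in iota 0 3 by rewrite mem_iota; lia.
  by lia.
- move=> i i3; rewrite -p1E; last by lia.
  have /chk1/N.leb_le : i \in iota 0 2 by rewrite mem_iota; lia.
  by lia.
rewrite -TE; last by lia.
have -> : (B - 2).+2 = B by lia.
by move: (B ^ 2) chk0 => b; lia.
Qed.

End Table.

Lemma no_two_ratio_23 n : 130 <= n -> 100 * no_two_count n <= 23 * pbar n.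
Proof.
have sizeT : size (pbar_table 210) = 211 by vm_compute.
have TE m : m < size (pbar_table 210) ->
    N.to_nat (nth 0%num (pbar_table 210) m) = pbar m.
  by rewrite sizeT => m210; apply: pbar_tableE.
(* The large constant C serves two ends: 100 C bounds the total excess of 100 d(m) over 23 p(m) for
   m < 130, and C n^2 is at most p(n - 2) from n = 205 on. *)
have check : ratio_check (pbar_table 210)
    23%num 100%num 144150535375%num 130 205 by vm_compute.
move: (pbar_table 210) sizeT TE check => T sizeT TE check n130.
by apply: (ratio_checkP TE _ _ _ check n130); rewrite ?sizeT.
Qed.

(** * Splitting a 2 into 1 + 1 *)

Lemma perm_rank s t : perm_eq s t -> rank s = rank t.
Proof.
move=> st; rewrite /rank (perm_size st); congr (Posz _ - _)%R.
exact/perm_big/perm_map.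
Qed.

(** The second condition leaves another part of size at least 2, so splitting preserves the largest
    part. *)
Definition splittable (s : seq (nat * bool)) : bool :=
  ((2, false) \in s) && (1 < \max_(k <- unzip1 (rem (2, false) s)) k).

Definition split_two (s : seq (nat * bool)) : seq (nat * bool) :=
  sort part_ge [:: (1, false), (1, false) & rem (2, false) s].

Lemma split_two_perm s :
  perm_eq (split_two s) [:: (1, false), (1, false) & rem (2, false) s].
Proof. by rewrite perm_sort. Qed.

Lemma split_two_overpartition n s : s \in overpartitions n ->
  (2, false) \in s -> split_two s \in overpartitions n.
Proof.
move=> ss s2; have rs := rem_overpartition ss s2.
have := overpartition_le ss s2 => /= n2.
move: rs; rewrite mem_overpartitions is_overpartitionE => /and3P[_ vs /eqP su].
apply: sort_overpartition; first by rewrite !valid_cons ?vs.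
by rewrite /= su /=; lia.
Qed.

Lemma rank_split_two s : splittable s -> rank s = (rank (split_two s) + 1)%R.
Proof.
case/andP=> s2 max2; rewrite (perm_rank (split_two_perm s)).
rewrite (perm_rank (perm_to_rem s2)) /rank /= !big_cons /=.
by move: max2; move: (\max_(k <- _) k) => m; lia.
Qed.

Lemma split_two_inj n s t : s \in overpartitions n -> t \in overpartitions n ->
  (2, false) \in s -> (2, false) \in t -> split_two s = split_two t -> s = t.
Proof.
move=> ss tt s2 t2 eq_st; apply: (overpartition_perm ss tt).
rewrite (permPl (perm_to_rem s2)) (permPr (perm_to_rem t2)) perm_cons.
rewrite -(perm_cons (1, false)) -(perm_cons (1, false)).
by rewrite -(permPl (split_two_perm s)) eq_st split_two_perm.
Qed.

(** All parts are 1, so the only choice is whether one of them is overlined. *)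
Lemma ovcount_ones n : ovcount (all (fun x => x.1 < 2)) n <= 2.
Proof.
rewrite /ovcount -size_filter -(size_map (fun s => (1, true) \in s)).
apply: (@uniq_leq_size _ _ [:: true; false]) => [|b _]; last by case: b.
rewrite map_inj_in_uniq ?filter_uniq ?overpartitions_uniq// => s t.
rewrite !mem_filter => /andP[s1 ss] /andP[t1 tt] eq_st.
apply: (overpartition_perm ss tt).
have ones r : all (fun x : nat * bool => x.1 < 2) r -> r \in overpartitions n ->
    (forall x, x \in r -> x.1 = 1) /\
    count_mem (1, false) r + ((1, true) \in r) = n.
  move=> r1 rr; have r1' x : x \in r -> x.1 = 1.
    move=> xr; have := overpartition_gt0 rr xr.
    by move: r1 => /allP/(_ _ xr); case: x {xr} => i b /=; lia.
  split=> //; rewrite -(count_overlined _ rr).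
  move: rr; rewrite mem_overpartitions is_overpartitionE => /and3P[_ _ /eqP <-].
  elim: r r1' {r1} => // -[i b] r IHr r1 /=.
  rewrite -IHr => [|x xr]; last by rewrite r1// inE xr orbT.
  have /= -> := r1 _ (mem_head _ _).
  by rewrite !xpair_eqE /=; case: b {r1}; lia.
have [s1' sn] := ones _ s1 ss; have [t1' tn] := ones _ t1 tt.
apply/allP => x; rewrite mem_cat => xst.
have /= : x.1 = 1 by case/orP: xst => [/s1'|/t1'].
case: x {xst} => i [] /= ->.
  by rewrite (count_overlined _ ss) (count_overlined _ tt) eq_st.
by apply/eqP/(@addIn ((1, true) \in t)); rewrite tn -eq_st sn.
Qed.

Lemma unsplittable_count n :
  ovcount (fun s => ~~ splittable s) n <= no_two_count n + 2.
Proof.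
apply: (@leq_trans (ovcount (predU (avoids [:: (2, false)])
    (fun s => ((2, false) \in s) && ~~ splittable s)) n)).
  apply: sub_count => s /= ns; rewrite ns andbT avoids_cons.
  by rewrite /avoids all_predT; case: (_ \in s).
rewrite /ovcount -[leqLHS]addn0 -(leq_add2r (count (predI (avoids [:: (2, false)])
    (fun s => ((2, false) \in s) && ~~ splittable s)) (overpartitions n))).
rewrite addn0 count_predUI -addnA leq_add2l.
apply: leq_trans (leq_addr _ _).
(* If an unsplittable overpartition contains a non-overlined 2, removing it leaves only 1s. *)
apply: leq_trans (ovcount_ones (n - 2)).
apply: (@ovcount_inj _ _ _ _ (rem (2, false))) => [s ss /andP[s2]|s t ss tt].
  rewrite /splittable s2 /= -leqNgt => max1.
  rewrite (rem_overpartition ss s2) /=; apply/allP => x xr; rewrite ltnS.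
  by apply: leq_trans max1; apply: leq_bigmax_seq; rewrite ?map_f.
move=> /andP[s2 _] /andP[t2 _] eq_st; apply: (overpartition_perm ss tt).
rewrite (permPl (perm_to_rem s2)) (permPr (perm_to_rem t2)).
by rewrite eq_st.
Qed.

(** * Comparing residue classes of the rank *)

Lemma sum_eqmodz (c : nat) (z a : int) : 0 < c ->
  \sum_(i < c) (z == (a + i%:Z)%R %[mod c])%Z = 1.
Proof.
move=> c0; have c0' : (c%:Z != 0 :> int)%R by lia.
have r0 := modz_ge0 (z - a)%R c0'; have rc := ltz_mod (z - a)%R c0'.
have zE := divz_eq (z - a)%R c; set q := divz _ _ in zE.
set r := modz _ _ in r0 rc zE.
have rlt : `|r|%N < c by lia.
rewrite (bigD1 (Ordinal rlt)) //= big1 => [|i iNr].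
  rewrite addn0 eqz_mod_dvd.
  have -> : (z - (a + `|r|%N%:Z) = q * c%:Z)%R by lia.
  by rewrite dvdz_mull.
apply/eqP; rewrite eqb0 eqz_mod_dvd; apply: contra iNr => /dvdzP[k kE].
apply/eqP/val_inj => /=; have ic := ltn_ord i.
have kq : ((k - q) * c = r - i%:Z)%R by lia.
have : (k - q)%R = 0%R.
  have [|/eqP|] := ltgtP (k - q)%R 0%R => //; nia.
lia.
Qed.

Lemma sum_ovcount_rank P (c n : nat) (a : int) : 0 < c ->
  \sum_(i < c) ovcount (fun s => P s && (rank s == (a + i%:Z)%R %[mod c])%Z) n =
  ovcount P n.
Proof.
move=> c0; rewrite /ovcount.
under eq_bigr do rewrite -sum1_count big_mkcond.
rewrite exchange_big -sum1_count [RHS]big_mkcond /=.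
apply: eq_bigr => s _; case: (P s) => /=; last by rewrite big1.
rewrite -[RHS](sum_eqmodz (rank s) a c0).
by apply: eq_bigr => i _; case: eqP.
Qed.

Lemma sum_Nbar c n a : 0 < c -> \sum_(i < c) Nbar (a + i%:Z)%R c n = pbar n.
Proof.
move=> c0; rewrite -ovcount_predT -(sum_ovcount_rank predT n a c0).
by apply: eq_bigr => i _; rewrite NbarE.
Qed.

(** Splitting a 2 maps the splittable members of class a + 1 injectively into class a. The error
    term keeps its residue so that such errors can be summed. *)
Lemma Nbar_succ c n a : Nbar (a + 1)%R c n <= Nbar a c n +
  ovcount (fun s => ~~ splittable s && (rank s == (a + 1)%R %[mod c])%Z) n.
Proof.
rewrite !NbarE; set P := fun s : seq (nat * bool) => (rank s == _ %[mod c])%Z.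
apply: (@leq_trans (ovcount (fun s => splittable s && P s) n +
                    ovcount (fun s => ~~ splittable s && P s) n)).
  rewrite /ovcount -count_predUI; apply: leq_trans (leq_addr _ _).
  by apply: sub_count => s /= ->; rewrite !andbT orbN.
rewrite leq_add2r; apply: (@ovcount_inj _ _ _ _ split_two).
  move=> s ss /andP[sp]; rewrite /P split_two_overpartition//; last by case/andP: sp.
  by rewrite (rank_split_two sp) eqz_modDr.
by move=> s t ss tt /andP[/andP[s2 _] _] /andP[/andP[t2 _] _]; apply: (split_two_inj ss).
Qed.

(** Chaining i unit steps costs the unsplittable members of classes a + 1, ..., a + i. These classes
    are distinct, so the total cost does not grow with i. *)
Lemma Nbar_add c n a i : i < c ->
  Nbar (a + i%:Z)%R c n <= Nbar a c n + (no_two_count n + 2).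
Proof.
move=> ic; have c0 : 0 < c by lia.
pose u (j : nat) := ovcount (fun s => ~~ splittable s &&
  (rank s == (a + j%:Z)%R %[mod c])%Z) n.
have le_i j : Nbar (a + j%:Z)%R c n <= Nbar a c n + \sum_(1 <= k < j.+1) u k.
  elim: j => [|j IHj]; first by rewrite addr0 leq_addr.
  rewrite big_nat_recr//= addnA.
  have -> : (a + j.+1%:Z = a + j%:Z + 1)%R by lia.
  apply: leq_trans (Nbar_succ _ _ _) _; rewrite leq_add//.
  by rewrite /u (_ : a + j.+1%:Z = a + j%:Z + 1)%R//; lia.
apply: (leq_trans (le_i i)); rewrite leq_add2l.
apply: leq_trans (unsplittable_count n).
rewrite -(sum_ovcount_rank _ n a c0) -(big_mkord predT u).
rewrite [leqRHS](@big_cat_nat _ _ _ i.+1)//=.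
rewrite [X in _ <= X + _]big_ltn//.
by rewrite (leq_trans (leq_addl (u 0) _)) ?leq_addr.
Qed.

Lemma Nbar_bounds c n a : 0 < c ->
  pbar n <= c * Nbar a c n + c.-1 * (no_two_count n + 2) /\
  c * Nbar a c n <= pbar n + c.-1 * (no_two_count n + 2).
Proof.
case: c => // c _; set U := no_two_count n + 2.
have sumC x : c * x = \sum_(i < c) x by rewrite sum_nat_const card_ord.
rewrite -(sum_Nbar n a (ltn0Sn c)) big_ord_recl addr0 /=; split.
  rewrite mulSn -addnA leq_add2l -mulnDr sumC.
  by apply: leq_sum => i _; apply: Nbar_add; rewrite /bump /= add1n ltnS.
rewrite mulSn -addnA leq_add2l !sumC.
rewrite -big_split; apply: leq_sum => i _ /=.
(* For the upper bound, [c - i] further steps from class a + i + 1 wrap around to a modulo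
   [c.+1]. *)
have ic : c - i < c.+1 by lia.
have := @Nbar_add c.+1 n (a + i.+1%:Z)%R (c - i) ic.
rewrite NbarE [Nbar a _ _]NbarE /bump /= add1n.
congr (_ <= _); apply: eq_count => s.
have -> : (a + i.+1%:Z + (c - i)%:Z = 1 * c.+1%:Z + a)%R by have := ltn_ord i; lia.
by rewrite modzMDl.
Qed.

(** * Numbers of distinct parts and the case of general c *)

Lemma sum_no_two_count n : \sum_(m < n.+2) no_two_count m = pbar n.+1 + pbar n.
Proof.
elim: n => [|n IHn].
  by rewrite !big_ord_recl big_ord0 addn0 addnC !no_two_count_small.
by rewrite big_ord_recr IHn pbar_no_two /=; lia.
Qed.

Lemma leq_pbar n : pbar n <= pbar n.+1.
Proof. by rewrite pbar_no_one leq_addl. Qed.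

Lemma sum_no_two_count_le n : \sum_(m < n) no_two_count m <= 2 * pbar n.
Proof.
case: n => [|[|n]]; rewrite ?big_ord0// ?sum_no_two_count.
  rewrite big_ord_recl big_ord0 addn0 no_two_count_small//.
  by rewrite (leq_trans (leq_pbar 0))// leq_pmull.
by have := leq_pbar n; have := leq_pbar n.+1; lia.
Qed.

Lemma ovcount_avoids_mem L x n :
  ovcount (fun s => avoids L s && (x \in s)) n <= avoid_count L (n - x.1).
Proof.
apply: (@ovcount_inj _ _ _ _ (rem x)) => [s ss /andP[sL sx]|].
  rewrite rem_overpartition//; apply/allP => y /mem_rem.
  exact: (allP sL).
move=> s t ss tt /andP[_ sx] /andP[_ tx] eq_st; apply: (overpartition_perm ss tt).
by rewrite (permPl (perm_to_rem sx)) (permPr (perm_to_rem tx)) eq_st.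
Qed.

Lemma size_undup_le n s : s \in overpartitions n ->
  size (undup s) <= \sum_(1 <= k < n.+1) (((k, false) \in s) + ((k, true) \in s)).
Proof.
move=> ss; pose B (b : bool) := [seq (k, b) | k <- index_iota 1 n.+1].
have szB b : \sum_(1 <= k < n.+1) ((k, b) \in s) = size [seq x <- B b | x \in s].
  by rewrite size_filter count_map -sum1_count [RHS]big_mkcond.
rewrite big_split /= !szB -size_cat; apply: uniq_leq_size.
  exact: undup_uniq.
move=> [k b]; rewrite mem_undup mem_cat !mem_filter => xs; rewrite xs /=.
have kn : k \in index_iota 1 n.+1.
  have := overpartition_gt0 ss xs; have := overpartition_le ss xs => /=.
  by rewrite mem_index_iota; lia.
by case: b xs => _; rewrite !(map_f (fun k => (k, _))) ?orbT.
Qed.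

(** Removing one copy of (k, b) injects the overpartitions containing it into those of n - k.
    Summing over k and both values of b gives at most twice a sum of [no_two_count], which
    telescopes. *)
Lemma sum_distinct_parts n :
  \sum_(s <- overpartitions n | avoids [:: (2, false)] s) size (undup s) <=
  4 * pbar n.
Proof.
apply: (@leq_trans (\sum_(s <- overpartitions n | avoids [:: (2, false)] s)
   \sum_(1 <= k < n.+1) (((k, false) \in s) + ((k, true) \in s)))).
  rewrite [leqLHS]big_seq_cond [leqRHS]big_seq_cond.
  apply: leq_sum => s /andP[ss _]; exact: size_undup_le.
rewrite exchange_big /=.
apply: (@leq_trans (\sum_(1 <= k < n.+1) 2 * no_two_count (n - k))).
  apply: leq_sum => k _; rewrite big_split /= mul2n -addnn.
  have le b : \sum_(s <- overpartitions n | avoids [:: (2, false)] s) ((k, b) \in s) <=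
      no_two_count (n - k).
    apply: leq_trans (ovcount_avoids_mem _ (k, b) n); rewrite /ovcount -sum1_count.
    by rewrite [leqRHS]big_mkcondr.
  by rewrite leq_add.
rewrite -big_distrr /= (_ : 4 = 2 * 2)// -mulnA leq_mul2l /=.
apply: leq_trans (sum_no_two_count_le n).
rewrite big_add1 big_mkord /= (reindex_inj rev_ord_inj) /=.
by apply: leq_sum => m _; rewrite subnSK ?subKn// ltnW.
Qed.

Lemma size_overpartition n s : s \in overpartitions n -> size s <= n.
Proof. by case/imageP => t _ ->; rewrite size_map size_bseq. Qed.

(** Such an overpartition is recovered from K triples (part, overlined, multiplicity), each with at
    most 2 (n+1)^2 values. *)
Lemma few_distinct_parts K n :
  ovcount (fun s => size (undup s) <= K) n <= (2 * n.+1 ^ 2) ^ K.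
Proof.
pose T := ('I_n.+1 * bool * 'I_n.+1)%type.
pose enc (y : nat * bool * nat) : T := (inord y.1.1, y.1.2, inord y.2).
pose dec (y : T) : nat * bool * nat := (y.1.1 : nat, y.1.2, y.2 : nat).
have cardT : #|{: K.-tuple T}| = (2 * n.+1 ^ 2) ^ K.
  by rewrite card_tuple !card_prod card_ord card_bool; congr (_ ^ _); lia.
rewrite -cardT cardE -(size_map (fun h : K.-tuple T =>
  sort part_ge (tally_seq (map dec h)))) /ovcount -size_filter.
apply: uniq_leq_size; first by rewrite filter_uniq ?overpartitions_uniq.
move=> s; rewrite mem_filter => /andP[sK ss].
(* Padding triples have multiplicity 0 and vanish on expansion. *)
pose l := tally s ++ nseq (K - size (tally s)) ((0, false), 0).
have sz_tally : size (tally s) = size (undup s).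
  by rewrite -(perm_size (tallyEl s)) size_map.
have szl : size (map enc l) == K.
  by rewrite size_map size_cat size_nseq sz_tally subnKC.
apply/mapP; exists (Tuple szl); first by rewrite mem_enum.
have decK : map dec (map enc l) = l.
  rewrite -map_comp map_id_in// => -[[i b] m]; rewrite mem_cat mem_nseq.
  have [|_ /= /andP[_ /eqP[-> -> ->]]] := boolP (_ \in tally s); last first.
    by rewrite /dec /= !inordK.
  rewrite (perm_mem (tallyE s)) => /mapP[x]; rewrite mem_undup => xs [ib ->] _.
  rewrite /dec /enc /= !inordK// ltnS.
    exact: leq_trans (count_size _ _) (size_overpartition ss).
  by have := overpartition_le ss xs; rewrite -ib.
rewrite /= decK; have seq_l : tally_seq l = tally_seq (tally s).
  rewrite /l /tally_seq map_cat flatten_cat map_nseq /=.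
  by rewrite (_ : flatten (nseq _ [::]) = [::]) ?cats0//; elim: (K - _).
rewrite seq_l; move: (ss); rewrite mem_overpartitions is_overpartitionE => /andP[so _].
apply: (sorted_eq part_ge_trans part_ge_anti so); first exact: sort_sorted part_ge_total _.
by rewrite perm_sym perm_sort tallyK.
Qed.

(** Markov's inequality: each overpartition with more than K distinct entries contributes at least K
    + 1 to the sum in [sum_distinct_parts]. *)
Lemma no_two_count_le K n :
  K.+1 * no_two_count n <= 4 * pbar n + K.+1 * (2 * n.+1 ^ 2) ^ K.
Proof.
pose few (s : seq (nat * bool)) := size (undup s) <= K.
have -> : no_two_count n = ovcount (fun s => avoids [:: (2, false)] s && few s) n
   + ovcount (fun s => avoids [:: (2, false)] s && ~~ few s) n.
  rewrite /no_two_count /avoid_count /ovcount -!sum1_count.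
  by rewrite (bigID few).
rewrite mulnDr addnC leq_add//; last first.
  rewrite leq_mul//; apply: leq_trans (few_distinct_parts K n).
  by apply: sub_count => s /andP[].
apply: leq_trans (sum_distinct_parts n).
rewrite /ovcount -sum1_count big_distrr /= [leqRHS](bigID few) /=.
apply: leq_trans (leq_addl _ _); apply: leq_sum => s /andP[_].
by rewrite /few -ltnNge muln1.
Qed.

Lemma expn2_leq_pbar t n : t * t.+1 <= n.*2 -> 2 ^ t <= pbar n.
Proof. by rewrite -avoid_count_nil; apply: expn2_leq_avoid_count. Qed.

Lemma pow4_leq_expn2 L : (L + 2) ^ 4 <= 2 ^ (L + 8).
Proof.
elim: L => [|L IHL]; first by [].
have [L5|L5] := ltnP L 5; first by case: L L5 {IHL} => [|[|[|[|[|L]]]]].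
rewrite !addSn [2 ^ _]expnS; apply: leq_trans (leq_mul (leqnn 2) IHL).
rewrite !expnS expn0 muln1; set x := L + 2.
have x7 : 7 <= x by rewrite /x; lia.
nia.
Qed.

Lemma no_two_ratio_large c n : 0 < c -> 2 ^ 29 * c ^ 4 <= n ->
  2 * c * (no_two_count n + 2) < pbar n.
Proof.
move=> c0 cn.
have c4 : c <= c ^ 4 by rewrite -[leqLHS]expn1 leq_pexp2l.
have n0 : 0 < n by apply: leq_trans cn; rewrite muln_gt0 !expn_gt0 c0.
have cn12 : 6 * c <= n.
  apply: leq_trans cn; apply: leq_mul c4.
  by apply: (@leq_trans (2 ^ 3)); [|rewrite leq_exp2l].
set L := trunc_log 2 n.+1.
have /andP[Ln nL] : 2 ^ L <= n.+1 < 2 ^ L.+1 by exact: trunc_log_bounds.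
set X := 2 * n.+1 ^ 2.
have XL : X <= 2 ^ (2 * L + 3).
  rewrite (_ : 2 * L + 3 = 1 + L.+1 * 2); last by lia.
  by rewrite expnD expn1 expnM leq_mul// leq_exp2r// ltnW.
(* Chosen so that 2^t is twice (2^(2L+3))^(16c), hence exceeds X^(16c). *)
pose t := (16 * c) * (2 * L + 3) + 1.
have tn : t ^ 2 <= n.
  (* Compare fourth powers: t <= 2^5 c (L+2) and (L+2)^4 <= 2^8 2^L <= 2^8 (2n) give t^4 <= 2^29 c^4
     n <= n^2. *)
  rewrite -(@leq_exp2r _ _ 2)// -expnM.
  have tL : t <= 2 ^ 5 * c * (L + 2) by rewrite /t (_ : 2 ^ 5 = 32)//; nia.
  apply: (leq_trans (_ : _ <= (2 ^ 5 * c * (L + 2)) ^ 4)); first by rewrite leq_exp2r.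
  rewrite expnMn [X in X * _]expnMn -[(2 ^ 5) ^ 4]expnM.
  apply: (@leq_trans (2 ^ 20 * c ^ 4 * (2 ^ 8 * (2 * n)))).
    rewrite leq_mul//; apply: leq_trans (pow4_leq_expn2 L) _.
    by rewrite addnC expnD leq_mul//; apply: leq_trans Ln _; lia.
  rewrite (_ : 2 ^ 20 * _ * _ = 2 ^ 20 * 2 ^ 8 * 2 ^ 1 * c ^ 4 * n); last first.
    by rewrite expn1; move: (2 ^ 20) (2 ^ 8) (c ^ 4) => *; ring.
  have e29 : 29 = 20 + 8 + 1 by [].
  move: cn; rewrite e29 [2 ^ _]expnD [2 ^ (_ + _)]expnD.
  by move=> an; exact: leq_mul an (leqnn n).
have pbar_t : 2 ^ t <= pbar n.
  by apply: expn2_leq_pbar; move: tn; rewrite -mulnn -addnn; nia.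
have Xt : X ^ (16 * c) < pbar n.
  apply: leq_trans pbar_t; rewrite /t addn1 [X in _ < X]expnS.
  apply: (@leq_ltn_trans (2 ^ (16 * c * (2 * L + 3)))).
    by rewrite [_ * (2 * L + 3)]mulnC [leqRHS]expnM leq_exp2r//; lia.
  by have := expn_gt0 2 (16 * c * (2 * L + 3)); lia.
(* With K + 1 = 16c, the distinct-part term contributes at most p/2 to 2c (d + 2). The remaining 2cF
   + 4c is at most 6cF, which is below p/2 because 12cF <= XF < p. *)
have := no_two_count_le (16 * c).-1 n; rewrite prednK; last by lia.
have : X ^ (16 * c) = X * X ^ (16 * c).-1 by rewrite -expnS prednK//; lia.
rewrite -/X; move: (X ^ (16 * c).-1) => F XF le4.
have F0 : 0 < F.
  by have : 0 < X ^ (16 * c); rewrite ?expn_gt0 ?XF ?muln_gt0 /X//; lia.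
have X12 : 12 * c <= X by rewrite /X -mulnn; nia.
have XF12 : 12 * c * F <= X * F by rewrite leq_mul.
move: XF12 Xt le4; rewrite XF; move: (X * F) (no_two_count n) (pbar n) => xf d p.
nia.
Qed.

(** * Transfer to real numbers and conclusion *)

Local Open Scope ring_scope.

Lemma Nbar_boundsR (R : realType) c n a : (0 < c)%N ->
  (pbar n)%:R <= c%:R * (Nbar a c n)%:R + (c.-1)%:R * ((no_two_count n)%:R + 2) :> R /\
  c%:R * (Nbar a c n)%:R <= (pbar n)%:R + (c.-1)%:R * ((no_two_count n)%:R + 2) :> R.
Proof.
by move=> c0; rewrite -!natrD -!natrM -!natrD !ler_nat; apply: Nbar_bounds.
Qed.

Lemma no_two_ratioR (R : realType) n : (130 <= n)%N ->
  100 * (no_two_count n)%:R <= 23 * (pbar n)%:R :> R /\ 512 <= (pbar n)%:R :> R.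
Proof.
move=> n130; rewrite -!natrM !ler_nat no_two_ratio_23//; split=> //.
by apply: (@expn2_leq_pbar 9); lia.
Qed.

(** The exponent is nonnegative, so the exponential is at least 1; the other factors are compared
    one by one. *)
Lemma M_ge (R : realType) c n : (0 < c)%N -> M R c <= n%:R ->
  (2 ^ 29 * c ^ 4 <= n)%N.
Proof.
move=> c0 Mn; rewrite -(ler_nat R); apply: le_trans Mn; rewrite natrM !natrX /M.
have c1 : 1 <= c%:R :> R by rewrite ler1n.
have e1 : 1 <= expR (16 * c%:R ^+ 2 * (2 * c%:R ^+ 2 + pi) / pi ^+ 2) :> R.
  apply: le_trans (expR_ge1Dx _); rewrite lerDl.
  have c2 : 0 <= c%:R ^+ 2 :> R by rewrite exprn_ge0.
  apply: divr_ge0; last by rewrite exprn_ge0// pi_ge0.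
  by apply: mulr_ge0; [|apply: addr_ge0; rewrite ?pi_ge0//]; apply: mulr_ge0.
rewrite -[leLHS]mulr1 ler_pM// ?mulr_ge0 ?exprn_ge0//.
apply: ler_pM; rewrite ?exprn_ge0//; first lra.
by apply: ler_weXn2l.
Qed.

Theorem theorem3p1 (R : realType) :
  (forall (a : int) (n : nat), (2089 <= n)%N ->
     19 / 10 ^+ 4 * (pbar n)%:R < (Nbar a 3 n)%:R :> R /\
     (Nbar a 3 n)%:R < 6648 / 10 ^+ 4 * (pbar n)%:R :> R) /\
  (forall (a : int) (n : nat), (272 <= n)%N ->
     91 / 10 ^+ 4 * (pbar n)%:R < (Nbar a 4 n)%:R :> R /\
     (Nbar a 4 n)%:R < 4909 / 10 ^+ 4 * (pbar n)%:R :> R) /\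
  (forall (a : int) (n : nat), (449 <= n)%N ->
     103 / 10 ^+ 4 * (pbar n)%:R < (Nbar a 5 n)%:R :> R /\
     (Nbar a 5 n)%:R < 3897 / 10 ^+ 4 * (pbar n)%:R :> R) /\
  (forall (c : nat) (a : int) (n : nat), (6 <= c)%N -> M R c <= n%:R ->
     1 / (2 * c%:R) * (pbar n)%:R < (Nbar a c n)%:R :> R /\
     (Nbar a c n)%:R < 3 / (2 * c%:R) * (pbar n)%:R :> R).
Proof.
split; [|split; [|split]] => [a n n0|a n n0|a n n0|c a n c6 Mn].
- have [] := @Nbar_boundsR R 3 n a isT; have [] := @no_two_ratioR R n ltac:(lia).
  by rewrite /=; split; lra.
- have [] := @Nbar_boundsR R 4 n a isT; have [] := @no_two_ratioR R n ltac:(lia).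
  by rewrite /=; split; lra.
(* The tightest case: (1 - 0.92)/5 = 0.016 and (1 + 0.92)/5 = 0.384, while [512 <= pbar n] limits
   the effect of the summand 2 to 8/(5 * 512) < 0.0032. *)
- have [] := @Nbar_boundsR R 5 n a isT; have [] := @no_two_ratioR R n ltac:(lia).
  by rewrite /=; split; lra.
have c0 : (0 < c)%N by lia.
have [lo hi] := @Nbar_boundsR R c n a c0.
(* This makes [c%:R * (Nbar a c n)%:R] differ from [pbar n] by less than half of [pbar n]. *)
have := no_two_ratio_large c0 (M_ge c0 Mn).
rewrite -(ltr_nat R) !natrM natrD => small.
have cR : 0 < c%:R :> R by rewrite ltr0n.
have U0 : 0 <= (no_two_count n)%:R + 2 :> R by rewrite addr_ge0.
have : (c.-1)%:R * ((no_two_count n)%:R + 2) <= c%:R * ((no_two_count n)%:R + 2) :> R.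
  by rewrite ler_wpM2r// ler_nat leq_pred.
set U := (_%:R + 2) in lo hi small U0 *; move=> le.
by split; rewrite mulrAC ?ltr_pdivrMr ?ltr_pdivlMr ?mulr_gt0//; lra.
Qed.
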